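(* Let $\Sigma\subset\mathbb{R}^3$ be (the surface of) an ellipsoid, i.e. $\Sigma=\{(x,y,z)\in\mathbb{R}^3 : x^2/a^2+y^2/b^2+z^2/c^2=1\}$ with arbitrary $a,b,c>0$, endowed with the Riemannian metric induced from $\mathbb{R}^3$. Let $A$ be its surface area and $D$ its intrinsic diameter. Then $$\frac{A}{D^2}\leq\frac{\pi}{2}.$$
   Context: The intrinsic diameter is $D=\max_{p,q\in\Sigma}\mathrm{dist}(p,q)$, where $\mathrm{dist}$ is the geodesic distance on $\Sigma$ (not the Euclidean distance in $\mathbb{R}^3$). *)

(* Defs.v *)
From HB Require Import structures.
From mathcomp Require Import all_boot all_order all_algebra.
From mathcomp Require Import all_classical all_reals all_analysis.

Set Implicit Arguments.
Unset Strict Implicit.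
Unset Printing Implicit Defensive.

Import Order.TTheory GRing.Theory Num.Theory.
Import numFieldNormedType.Exports.

Local Open Scope classical_set_scope.
Local Open Scope ring_scope.

Section SurfacesInR3.
Context {R : realType}.
Implicit Types (p q u v : 'rV[R]_3) (S : set 'rV[R]_3).

Definition dot u v : R := \sum_(i < 3) u ord0 i * v ord0 i.

(* The library norm `|v| on row vectors is the max norm, so the Euclidean
   norm has to be introduced separately; both induce the same topology, hence
   the same derivatives of vector-valued functions. *)
Definition enorm v : R := Num.sqrt (dot v v).

(* C^1 on the closed interval [s, t], with one-sided derivatives at the ends:
   g coincides on [s, t] with a function that is C^1 on the whole line. *)
Definition C1_on (g : R -> 'rV[R]_3) (s t : R) :=
  exists h : R -> 'rV[R]_3,
    [/\ forall x, derivable h x 1,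
        continuous (derive1 h) &
        forall x, x \in `[s, t] -> g x = h x].

(* The breakpoints 0 = s_0 < s_1 < ... < s_n = 1 are the entries of 0 :: s. *)
Definition piecewise_C1 (g : R -> 'rV[R]_3) :=
  exists2 s : seq R, itv_partition 0 1 s &
    forall i : nat, (i < size s)%N ->
      C1_on g (nth 0 (0 :: s) i) (nth 0 s i).

Definition curves S p q : set (R -> 'rV[R]_3) :=
  [set g | [/\ piecewise_C1 g, g 0 = p, g 1 = q &
               forall t, t \in `[0, 1] -> S (g t)]].

(* At the finitely many breakpoints derive1 g may be meaningless, which does
   not affect the integral. *)
Definition curve_length (g : R -> 'rV[R]_3) : \bar R :=
  (\int[lebesgue_measure]_(t in `[0%R, 1%R]) (enorm (derive1 g t))%:E)%E.

Definition geodesic_dist S p q : \bar R :=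
  ereal_inf [set curve_length g | g in curves S p q].

Definition intrinsic_diameter S : \bar R :=
  ereal_sup [set geodesic_dist S p q | p in S & q in S].

(* Area of the surface parametrized by r over the set U of parameters: the
   density is the Riemannian one, sqrt (E G - F^2), for the metric induced
   from R^3. *)
Definition parametrized_area (r : R * R -> 'rV[R]_3) (U : set (R * R)) : \bar R :=
  (\int[lebesgue_measure \x lebesgue_measure]_(w in U)
     (let r1 := derive1 (fun x : R => r (x, w.2)) w.1 in
      let r2 := derive1 (fun x : R => r (w.1, x)) w.2 in
      Num.sqrt (dot r1 r1 * dot r2 r2 - dot r1 r2 ^+ 2))%:E)%E.

Definition vec3 (x y z : R) : 'rV[R]_3 := \row_(i < 3) [:: x; y; z]`_i.

Definition ellipsoid (a b c : R) : set 'rV[R]_3 :=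
  [set v | v ord0 0 ^+ 2 / a ^+ 2 + v ord0 1 ^+ 2 / b ^+ 2
           + v ord0 2 ^+ 2 / c ^+ 2 = 1].

(* Spherical coordinates: w.1 is the polar angle, w.2 the azimuth. *)
Definition ellipsoid_chart (a b c : R) (w : R * R) : 'rV[R]_3 :=
  vec3 (a * (sin w.1 * cos w.2)) (b * (sin w.1 * sin w.2)) (c * cos w.1).

(* On ]0, pi[ x ]0, 2 pi[ the chart is a diffeomorphism onto the complement in
   the ellipsoid of half an ellipse, which has area zero. *)
Definition ellipsoid_area (a b c : R) : \bar R :=
  parametrized_area (ellipsoid_chart a b c)
    (`]0, pi[%classic `*` `]0, 2 * pi[%classic).

End SurfacesInR3.

(* Main.v *)
Require Import Defs.
From mathcomp Require Import all_boot all_order all_algebra.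
From mathcomp Require Import all_classical all_reals all_analysis.
From mathcomp Require Import measurable_realfun ring lra.

(** Let [M] and [m] be the largest and the smallest semi-axis, and let [K] be the
    length of a quarter of the ellipse with semi-axes [M] and [m]. The theorem
    follows from two bounds: the diameter is at least [2 * K], and the area is at
    most [2 * pi * K ^+ 2], which is [pi / 2 * (2 * K) ^+ 2].

    The diameter ([le_ellipsoid_diameter]) is bounded below by the distance
    between the two ends of the longest axis. Let [s] be the arclength of the
    ellipse with semi-axes [M] and [m], measured from the end of its minor
    semi-axis. A point whose coordinate on the longest axis is [x] lies at the
    latitude [asin (x / M)]; assign to it the number [s (asin (x / M))]. Along a
    curve of the ellipsoid this number varies at most as fast as arclength, because
    the other two semi-axes are at least [m] ([latitude_speed_le]); between the two
    ends of the axis it varies from [- K] to [K]. The function [asin] is not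
    differentiable at -1 and 1, so [x / M] is first multiplied by a factor [k < 1],
    which then tends to 1 ([le_antipodal_curve_length]).

    For the area, replacing the middle semi-axis by [M] cannot decrease the density
    of the chart ([area_density_le]) and leaves an oblate ellipsoid of revolution.
    If its axis is the polar axis of the chart, its area is the double integral of
    a function of the polar angle only. Otherwise the density is
    [sin w.1 * g (u ^+ 2)], where [u] is one of the first two coordinates on the
    unit sphere, and [u] may be replaced by the third one: the moments of the three
    coordinates on the sphere agree by Wallis' formulas ([sphere_moment]), and [g]
    is a uniform limit of polynomials ([integral_sphere_le]).

    For the ellipsoid of revolution the area is [2 * pi] times the integral of the
    distance [r] to the axis against the arclength of a meridian. The meridian has
    length [2 * K], and [r] is zero at both ends and 1-Lipschitz in arclength;
    hence [r] is at most the arclength to the nearer end, whose integral is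
    [K ^+ 2] ([integral_radius_le]). *)

Set Implicit Arguments.
Unset Strict Implicit.
Unset Printing Implicit Defensive.

Import Order.TTheory GRing.Theory Num.Theory.
Import numFieldNormedType.Exports.

Local Open Scope classical_set_scope.
Local Open Scope ring_scope.

(** * Antiderivatives of continuous functions *)

Section Antiderivatives.
Context {R : realType}.
Implicit Types (f F G : R -> R) (a b : R).

Local Notation mu := (@lebesgue_measure R).

Lemma cvgX (T : Type) (A : set_system T) {FA : Filter A} (g : T -> R) (l : R) n :
  g @ A --> l -> (fun t => g t ^+ n) @ A --> l ^+ n.
Proof.
move=> gl; apply: (@continuous_cvg _ _ _ A FA g (fun x => x ^+ n) l) => //.
exact: exprn_continuous.
Qed.

Lemma is_derive_continuous F a l : is_derive a 1 F l -> {for a, continuous F}.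
Proof. by move=> -[dF _]; apply/differentiable_continuous/derivable1_diffP. Qed.

(** A constant of its own hides the type class [is_derive], so that applying a
    lemma with such a hypothesis does not start an instance search. *)
Definition antiderivative_on (i : interval R) F f :=
  forall x, x \in i -> is_derive x 1 F (f x).

Lemma within_is_derive F f a b :
  antiderivative_on `[a, b] F f ->
  {within `[a, b], continuous F}.
Proof. by move=> dF; apply: derivable_within_continuous => x /dF[]. Qed.

Lemma is_derive_ndecr F f a b : a <= b ->
  antiderivative_on `[a, b] F f ->
  {in `]a, b[, forall x, 0 <= f x} -> F a <= F b.
Proof.
move=> ab dF f0.
apply: (@ger0_derive1_ndecr _ F a b) => // [x xab|x xab|].
- by have [] := dF _ (subset_itv_oo_cc xab).
- have dFx := dF _ (subset_itv_oo_cc xab).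
  by rewrite derive1E derive_val f0.
- exact: within_is_derive dF.
Qed.

Lemma is_derive0_eq F a b : a <= b ->
  antiderivative_on `[a, b] F (cst 0) -> F a = F b.
Proof.
move=> ab dF; apply/le_anti/andP; split.
  exact: (@is_derive_ndecr _ (cst 0)).
rewrite -lerN2; apply: (@is_derive_ndecr (- F) (cst 0)) => // x xab.
by have ? := dF _ xab; apply: is_derive_eq; rewrite oppr0.
Qed.

Lemma ex_antiderivative f a b : continuous f ->
  exists F, antiderivative_on `]a, b[ F f.
Proof.
move=> cf.
have ic : forall u v, mu.-integrable `[u, v] (EFin \o f).
  move=> u v; apply: continuous_compact_integrable; first exact: segment_compact.
  exact: continuous_subspaceT.
exists (fun x => (\int[mu]_(t in `[a, x]) f t)%R) => x.
rewrite in_itv/= => /andP[ax xb].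
have [dF Ff] := continuous_FTC1_closed xb (ic a b) ax (cf x).
by split; [exact: dF | rewrite -derive1E].
Qed.

Lemma integral_derive f F a b : a < b -> continuous f ->
  antiderivative_on `[a, b] F f ->
  (\int[mu]_(t in `[a, b]) (f t)%:E = (F b - F a)%:E)%E.
Proof.
move=> ab cf dF; rewrite EFinB; apply: continuous_FTC2 => //.
- exact: continuous_subspaceT.
- have [_ cFa cFb] := (continuous_within_itvP F ab).1 (within_is_derive dF).
  by split => // x /subset_itv_oo_cc /dF[].
- by move=> x /subset_itv_oo_cc /dF dFx; rewrite derive1E derive_val.
Qed.

(** Comparing antiderivatives instead of integrands spares any regularity
    assumption on the derivative of [F]. *)
Lemma derive_le_integral f F g a b : a < b -> continuous f ->
  antiderivative_on `[a, b] F g ->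
  {in `]a, b[, forall x, g x <= f x} ->
  ((F b - F a)%:E <= \int[mu]_(t in `[a, b]) (f t)%:E)%E.
Proof.
move=> ab cf dF gf; have [G dG] := @ex_antiderivative f (a - 1) (b + 1) cf.
have {}dG : antiderivative_on `[a, b] G f.
  move=> x; rewrite in_itv/= => /andP[ax xb].
  by apply: dG; rewrite in_itv/=; apply/andP; split; lra.
rewrite (integral_derive ab cf dG) lee_fin.
have : G a - F a <= G b - F b.
  apply: (@is_derive_ndecr (G - F) (f - g)) => [|x xab|x xab].
  - exact: ltW.
  - by have ? := dF _ xab; have ? := dG _ xab; exact: is_deriveB.
  - by rewrite /= subr_ge0; exact: gf.
lra.
Qed.

End Antiderivatives.

(** * The arclength of an ellipse *)

Section Meridian.
Context {R : realType}.
Implicit Types (M m x t : R).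

Local Notation mu := (@lebesgue_measure R).

Lemma pi_lt4 : pi < 4 :> R.
Proof. by have := @pihalf_lt2 R; lra. Qed.

(** The speed of [t |-> (M * sin t, m * cos t)]. *)
Definition meridian_speed M m t : R :=
  Num.sqrt (M ^+ 2 * cos t ^+ 2 + m ^+ 2 * sin t ^+ 2).

(** The bound 4 on the parameter exceeds [pi]: the parameters of interest lie
    between [- (pi / 2)] and [pi]. *)
Definition meridian_arclength M m (s : R -> R) :=
  s 0 = 0 /\ antiderivative_on `](-4), 4[ s (meridian_speed M m).

Lemma continuous_meridian_speed M m : continuous (meridian_speed M m).
Proof.
move=> x; apply: (@continuous_comp _ _ _
  (fun t => M ^+ 2 * cos t ^+ 2 + m ^+ 2 * sin t ^+ 2) Num.sqrt);
  last exact: sqrt_continuous.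
apply: cvgD; apply: cvgM; try exact: cvg_cst.
- by apply: cvgX; exact: continuous_cos.
- by apply: cvgX; exact: continuous_sin.
Qed.

Lemma continuous_radius_speed M m :
  continuous (fun t => M * sin t * meridian_speed M m t).
Proof.
move=> t; apply: cvgM; last exact: continuous_meridian_speed.
by apply: cvgM; [exact: cvg_cst|exact: continuous_sin].
Qed.

Lemma ex_meridian_arclength M m : exists s, meridian_arclength M m s.
Proof.
have [s ds] := ex_antiderivative (-4) 4 (@continuous_meridian_speed M m).
exists (s - cst (s 0)); split; first by rewrite fctE/= subrr.
move=> x x4; have ? := ds x x4.
by apply: is_derive_eq; rewrite subr0.
Qed.

Lemma meridian_speedN M m t : meridian_speed M m (- t) = meridian_speed M m t.
Proof. by rewrite /meridian_speed cosN sinN sqrrN. Qed.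

Lemma meridian_speedBpi M m t :
  meridian_speed M m (pi - t) = meridian_speed M m t.
Proof.
rewrite /meridian_speed -[pi - t]opprB cosN sinN cosB sinB cospi sinpi.
by rewrite !mulr0 addr0 subr0 !mulrN1 !sqrrN.
Qed.

Lemma meridian_speed_ge M m t : 0 <= M -> M * cos t <= meridian_speed M m t.
Proof.
move=> M0; rewrite (le_trans (ler_norm _))// -sqrtr_sqr ler_sqrt.
  by rewrite exprMn lerDl mulr_ge0 ?sqr_ge0.
by rewrite addr_ge0// mulr_ge0 ?sqr_ge0.
Qed.

Lemma meridian_speed_ge0 M m t : 0 <= meridian_speed M m t.
Proof. exact: sqrtr_ge0. Qed.

Section arclength.
Variables (M m : R) (s : R -> R).
Hypothesis sP : meridian_arclength M m s.

Let ds x : x \in `](-4), 4[ -> is_derive x 1 s (meridian_speed M m x).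
Proof. exact: sP.2. Qed.

Lemma arclengthN x : x \in `[0, pi / 2] -> s (- x) = - s x.
Proof.
rewrite in_itv/= => /andP[x0 xpi]; have pi2 := @pihalf_lt2 R.
apply/eqP; rewrite -subr_eq0 opprK; apply/eqP.
suff : (s \o -%R + s) 0 = (s \o -%R + s) x.
  by rewrite !fctE/= oppr0 sP.1 addr0.
apply: (@is_derive0_eq _ (s \o -%R + s)) => [//|y]; rewrite in_itv/= => /andP[y0 yx].
have d1 : is_derive y 1 s (meridian_speed M m y).
  by apply: ds; rewrite in_itv/=; apply/andP; split; lra.
have d2 : is_derive (- y) 1 s (meridian_speed M m (- y)).
  by apply: ds; rewrite in_itv/=; apply/andP; split; lra.
have d3 := is_derive1_comp d2 (is_deriveNid y 1).
by apply: is_derive_eq; rewrite meridian_speedN; ring.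
Qed.

Lemma arclengthBpi x : x \in `[0, pi] -> s (pi - x) = s (pi / 2) *+ 2 - s x.
Proof.
rewrite in_itv/= => /andP[x0 xpi]; apply/eqP; rewrite eq_sym subr_eq; apply/eqP.
have pi4 := pi_lt4.
pose f t := s (pi - t) + s t.
have df : antiderivative_on `[0, pi] f (cst 0).
  move=> y; rewrite in_itv/= => /andP[y0 ypi].
  have d1 : is_derive y 1 s (meridian_speed M m y).
    by apply: ds; rewrite in_itv/=; apply/andP; split; lra.
  have d2 : is_derive ((cst pi - id) y) 1 s (meridian_speed M m (pi - y)).
    by apply: ds; rewrite in_itv/= !fctE/=; apply/andP; split; lra.
  have d4 : is_derive y 1 (cst pi - id) (-1 : R).
    by apply: is_derive_eq; rewrite sub0r.
  have d3 := is_derive1_comp d2 d4.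
  suff : is_derive y 1 (s \o (cst pi - id) + s) 0 by [].
  by apply: is_derive_eq; rewrite meridian_speedBpi; ring.
have f0 (y : R) : y \in `[0, pi] -> f 0 = f y.
  rewrite in_itv/= => /andP[y0 ypi].
  apply: (@is_derive0_eq _ f) => [//|z]; rewrite in_itv/= => /andP[z0 zy].
  by apply: df; rewrite in_itv/= z0 (le_trans zy).
have -> : s (pi - x) + s x = f x by [].
rewrite -f0; last by rewrite in_itv/= x0.
rewrite (f0 (pi / 2)) ?in_itv/=; last by apply/andP; split; lra.
have -> : f (pi / 2) = s (pi - pi / 2) + s (pi / 2) by [].
by have -> : pi - pi / 2 = pi / 2 :> R by field.
Qed.

(** The distance [M * sin x] of the meridian to its axis is 1-Lipschitz in the
    arclength. *)
Lemma radius_le_arclength x : 0 <= M -> x \in `[0, pi] -> M * sin x <= s x.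
Proof.
move=> M0; rewrite in_itv/= => /andP[x0 xpi].
have pi4 := pi_lt4.
have : (s - M *: sin) 0 <= (s - M *: sin) x.
  apply: (@is_derive_ndecr _ (s - M *: sin) (meridian_speed M m - M *: cos)) => // y.
    rewrite in_itv/= => /andP[y0 yx].
    have d1 : is_derive y 1 s (meridian_speed M m y).
      by apply: ds; rewrite in_itv/=; apply/andP; split; lra.
    exact: is_deriveB.
  by move=> _; rewrite fctE/= subr_ge0; exact: meridian_speed_ge.
by rewrite !fctE/= sin0 sP.1 [M *: 0]mulr0 subr0 subr_ge0.
Qed.

(** A meridian of length [2 * s (pi / 2)] stays within the distance
    [min (s x) (2 * s (pi / 2) - s x)] of the axis; integrating this bound
    against arclength gives the disc of radius [s (pi / 2)]. *)
Lemma integral_radius_le : 0 <= M ->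
  (\int[mu]_(t in `[0%R, pi]) (M * sin t * meridian_speed M m t)%:E
     <= (s (pi / 2) ^+ 2)%:E)%E.
Proof.
move=> M0; set K := s (pi / 2); set f := fun t => M * sin t * meridian_speed M m t.
have cf : continuous f by exact: continuous_radius_speed.
have pi4 := pi_lt4.
have pi0 := @pi_gt0 R.
have [F dF] := @ex_antiderivative _ f (-4) 4 cf.
have {}dF : antiderivative_on `[0, pi] F f.
  move=> x; rewrite in_itv/= => /andP[x0 xpi].
  by apply: dF; rewrite in_itv/=; apply/andP; split; lra.
have dsI : antiderivative_on `[0, pi] s (meridian_speed M m).
  move=> x; rewrite in_itv/= => /andP[x0 xpi].
  by apply: ds; rewrite in_itv/=; apply/andP; split; lra.
have sub1 (x : R) : x \in `[0, pi / 2] -> x \in `[0, pi].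
  by rewrite !in_itv/= => /andP[x0 xpi]; apply/andP; split; lra.
have sub2 (x : R) : x \in `[pi / 2, pi] -> x \in `[0, pi].
  by rewrite !in_itv/= => /andP[x0 xpi]; apply/andP; split; lra.
rewrite (integral_derive pi0 cf dF) lee_fin.
have spi : s pi = K *+ 2.
  have := @arclengthBpi 0; rewrite in_itv/= lexx pi_ge0 sP.1 !subr0; exact.
(* [s ^+ 2 / 2] is an antiderivative of [s] times the speed. *)
pose G1 t := 2^-1 * (s t * s t) - F t.
have h1 : G1 0 <= G1 (pi / 2).
  apply: (@is_derive_ndecr _ G1 (fun t => s t * meridian_speed M m t - f t))
    => [|x xab|x xab].
  - by rewrite divr_ge0// ltW.
  - have ? := dF _ (sub1 _ xab); have ? := dsI _ (sub1 _ xab).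
    suff : is_derive x 1 (2^-1 *: (s * s) - F) (s x * meridian_speed M m x - f x) by [].
    by apply: is_derive_eq; rewrite /GRing.scale/=; field.
  - rewrite subr_ge0 ler_wpM2r ?meridian_speed_ge0//.
    exact/radius_le_arclength/sub1/subset_itv_oo_cc.
pose G2 t := K *+ 2 * s t - 2^-1 * (s t * s t) - F t.
have h2 : G2 (pi / 2) <= G2 pi.
  apply: (@is_derive_ndecr _ G2 (fun t => (K *+ 2 - s t) * meridian_speed M m t - f t))
    => [|x xab|x xab].
  - lra.
  - have ? := dF _ (sub2 _ xab); have ? := dsI _ (sub2 _ xab).
    suff : is_derive x 1 (K *+ 2 *: s - 2^-1 *: (s * s) - F)
      ((K *+ 2 - s x) * meridian_speed M m x - f x) by [].
    by apply: is_derive_eq; rewrite /GRing.scale/=; field.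
  - rewrite subr_ge0 ler_wpM2r ?meridian_speed_ge0//.
    have {}xab := subset_itv_oo_cc xab.
    rewrite -arclengthBpi ?sub2//.
    have -> : sin x = sin (pi - x).
      by rewrite -[pi - x]opprB sinN sinB cospi sinpi mulr0 subr0 mulrN1 opprK.
    apply: radius_le_arclength => //; move: (sub2 _ xab).
    by rewrite !in_itv/= => /andP[x0 xpi]; apply/andP; split; lra.
move: h1 h2; rewrite /G1 /G2 sP.1 spi -/K; lra.
Qed.

End arclength.
End Meridian.

(** * Lower bounds for the length of a piecewise C1 curve *)

Section CurveLength.
Context {R : realType}.
Implicit Types (g h : R -> 'rV[R]_3) (a b t : R).

Local Notation mu := (@lebesgue_measure R).

Lemma enorm3 (v : 'rV[R]_3) :
  enorm v = Num.sqrt (v ord0 0 ^+ 2 + v ord0 1 ^+ 2 + v ord0 2 ^+ 2).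
Proof.
rewrite /enorm /dot !big_ord_recl big_ord0 addr0 addrA -!expr2.
by congr (Num.sqrt (_ + _ ^+ 2 + _ ^+ 2)); congr (v ord0 _); apply/val_inj.
Qed.

Lemma continuous_enorm : continuous (@enorm R).
Proof.
have -> : @enorm R = Num.sqrt \o
    (fun v => v ord0 0 ^+ 2 + v ord0 1 ^+ 2 + v ord0 2 ^+ 2).
  by apply/funext => v; exact: enorm3.
move=> v; apply: continuous_comp; last exact: sqrt_continuous.
have cX i : (fun w : 'rV[R]_3 => w ord0 i ^+ 2) @ v --> v ord0 i ^+ 2.
  exact: cvgX (@coord_continuous R 1 3 ord0 i v).
exact: (cvgD (cvgD (cX 0) (cX 1)) (cX 2)).
Qed.

Lemma continuous_speed h : continuous (derive1 h) ->
  continuous (fun t => enorm (derive1 h t)).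
Proof.
by move=> ch t; apply: continuous_comp; [exact: ch|exact: continuous_enorm].
Qed.

Lemma speed_near g h a b : {in `[a, b], g =1 h} ->
  {in `]a, b[, (fun t => enorm (derive1 g t)) =1 (fun t => enorm (derive1 h t))}.
Proof.
move=> gh t tab; rewrite !derive1E (@near_eq_derive _ _ _ g h)//.
by near=> u; apply/gh/subset_itv_oo_cc; near: u; exact: near_in_itvoo.
Unshelve. all: by end_near. Qed.

Lemma integral_continuous_itvoo (f k : R -> R) a b : continuous f ->
  {in `]a, b[, k =1 f} ->
  measurable_fun `[a, b[ (EFin \o k) /\
  (\int[mu]_(t in `[a, b[) (k t)%:E = \int[mu]_(t in `[a, b]) (f t)%:E)%E.
Proof.
move=> cf kf; have mf : measurable_fun `]a, b[ f.
  by apply: measurable_funS (continuous_measurable_fun cf).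
have mk : measurable_fun `]a, b[ (EFin \o k).
  apply/measurable_EFinP; apply: eq_measurable_fun mf => t.
  by rewrite inE => tab; exact/esym/kf.
split; first by apply: (emeasurable_fun_itv_obnd_cbndP _ _ _).1.
rewrite (integral_itv_bndoo _ _ mk) (@integral_itv_bndoo _ _ _ (EFin \o f)).
  by apply: eq_integral => t; rewrite inE => tab; congr EFin; exact: kf.
exact/measurable_EFinP.
Qed.

(** The measurability of [k], which is known piecewise only, is proved in the same
    induction because the additivity of the integral requires it. *)
Lemma le_integral_itv_partition (k L : R -> R) a b (l : seq R) :
  (forall t, 0 <= k t) -> itv_partition a b l ->
  (forall i, (i < size l)%N ->
     let u := nth 0 (a :: l) i in let v := nth 0 l i in
     exists f, [/\ continuous f, {in `]u, v[, k =1 f} &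
       ((L v - L u)%:E <= \int[mu]_(t in `[u, v]) (f t)%:E)%E]) ->
  measurable_fun `[a, b] (EFin \o k) /\
  ((L b - L a)%:E <= \int[mu]_(t in `[a, b]) (k t)%:E)%E.
Proof.
move=> k0; elim: l a => [a /itv_partition_nil <- _|c l IH a acl kacl].
  rewrite set_itv1 integral_set1 subrr; split => //.
  exact: measurable_fun_set1.
have ac : a < c by case: acl => /= /andP[].
have cl := itv_partition_cons acl; have cb := itv_partition_le cl.
have [mc lc] := IH c cl (fun i => kacl i.+1).
have /= [f [cf kf Lf]] := kacl 0%N isT.
have [ma fa] := integral_continuous_itvoo cf kf.
have -> : `[a, b]%classic = `[a, c[%classic `|` `[c, b]%classic.
  rewrite (@itv_bndbnd_setU _ _ _ (BLeft c)) ?bnd_simp; [by []| |].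
  - exact: ltW.
  - exact: cb.
have mab : measurable_fun (`[a, c[%classic `|` `[c, b]%classic) (EFin \o k).
  by apply/measurable_funU.
split; first exact: mab.
rewrite ge0_integral_setU//=.
- rewrite fa -(subrK (L c) (L b)) -addrA EFinD [leRHS]addeC.
  exact: leeD.
- by move=> t _; rewrite lee_fin.
- apply/disj_setPS => y [/=]; rewrite 2!in_itv/= => /andP[_ yx] /andP[].
  by rewrite leNgt yx.
Qed.

Lemma le_curve_length g (L : R -> R) : piecewise_C1 g ->
  (forall a b h, 0 <= a -> a < b -> b <= 1 ->
     (forall t, derivable h t 1) -> continuous (derive1 h) ->
     {in `[a, b], g =1 h} ->
     ((L b - L a)%:E <= \int[mu]_(t in `[a, b]) (enorm (derive1 h t))%:E)%E) ->
  ((L 1 - L 0)%:E <= curve_length g)%E.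
Proof.
move=> [l l01 gl] Lh.
have speed_ge0 t : 0 <= enorm (derive1 g t) by exact: sqrtr_ge0.
apply: (le_integral_itv_partition speed_ge0 l01 _).2 => i il u v.
have [h [dh ch gh]] := gl i il.
exists (fun t => enorm (derive1 h t)); split.
- exact: continuous_speed.
- exact: speed_near.
have [l_sorted _] := l01.
have nth_ge0 j : (j < (size l).+1)%N -> 0 <= nth 0 (0 :: l) j.
  move=> jl; have := itv_partition_nth_ge jl l01.
  by rewrite (set_nth_default 0).
have nth_le1 j : (j < (size l).+1)%N -> nth 0 (0 :: l) j <= 1.
  move=> jl; have := itv_partition_nth_le jl l01.
  by rewrite (set_nth_default 0).
apply: (Lh u v h _ _ _ dh ch gh).
- exact/nth_ge0/ltnW.
- exact: (pathP 0 l_sorted).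
- exact: (nth_le1 i.+1).
Qed.

End CurveLength.

(** * A lower bound for the diameter of an ellipsoid *)

Section Diameter.
Context {R : realType}.
Implicit Types (M m k : R) (p q : 'rV[R]_3) (g : R -> 'rV[R]_3).

Local Notation mu := (@lebesgue_measure R).

(** By Cauchy-Schwarz a tangent vector of the ellipsoid is at least as long as
    the meridian vector with the same first coordinate on the ellipsoid of
    revolution of semi-axes [M], [m], [m]. Shrinking [x / M] by the factor
    [k < 1] keeps the bound and moves away from the poles, where the formula is
    singular. *)
Lemma latitude_speed_le M m b c k w (x y z dx dy dz : R) :
  0 < M -> 0 < m -> m <= b -> m <= c -> 0 <= k < 1 ->
  x ^+ 2 / M ^+ 2 + y ^+ 2 / b ^+ 2 + z ^+ 2 / c ^+ 2 = 1 ->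
  x * dx / M ^+ 2 + y * dy / b ^+ 2 + z * dz / c ^+ 2 = 0 ->
  w = k * (x / M) ->
  k * (dx / M) * ((Num.sqrt (1 - w ^+ 2))^-1 *
    Num.sqrt (M ^+ 2 * (1 - w ^+ 2) + m ^+ 2 * w ^+ 2)) <=
  Num.sqrt (dx ^+ 2 + dy ^+ 2 + dz ^+ 2).
Proof.
move=> M0 m0 mb mc /andP[k0 k1] E1 E2 wE; move: E1 E2 wE.
have b0 := lt_le_trans m0 mb; have c0 := lt_le_trans m0 mc.
set X := x / M; set Y := y / b; set Z := z / c.
set P := dx / M; set Q := dy / b; set T := dz / c.
have -> : x ^+ 2 / M ^+ 2 + y ^+ 2 / b ^+ 2 + z ^+ 2 / c ^+ 2 =
          X ^+ 2 + Y ^+ 2 + Z ^+ 2 by rewrite !expr_div_n.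
have -> : x * dx / M ^+ 2 + y * dy / b ^+ 2 + z * dz / c ^+ 2 =
          X * P + Y * Q + Z * T.
  by rewrite /X /Y /Z /P /Q /T; field; rewrite ?gt_eqF.
have -> : dx = M * P by rewrite /P; field; rewrite gt_eqF.
have -> : dy = b * Q by rewrite /Q; field; rewrite gt_eqF.
have -> : dz = c * T by rewrite /T; field; rewrite gt_eqF.
(* From here on [X], [Y], [Z] is a point of the unit sphere, and [P], [Q], [T]
   is a tangent vector at it. *)
move: X Y Z P Q T => X Y Z P Q T {x y z dx dy dz} XYZ XPQ wE.
have k2 : k ^+ 2 < 1 by rewrite expr_lt1.
have X2 : X ^+ 2 <= 1 by rewrite -XYZ -addrA lerDl addr_ge0 ?sqr_ge0.
have w2 : 0 < 1 - w ^+ 2.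
  rewrite subr_gt0 wE exprMn; have := sqr_ge0 k; have := sqr_ge0 X; nra.
have QT0 : 0 <= Q ^+ 2 + T ^+ 2 by rewrite addr_ge0 ?sqr_ge0.
have CS : (X * P) ^+ 2 <= (1 - X ^+ 2) * (Q ^+ 2 + T ^+ 2).
  have -> : X * P = - (Y * Q + Z * T) by lra.
  have -> : 1 - X ^+ 2 = Y ^+ 2 + Z ^+ 2 by lra.
  rewrite sqrrN -subr_ge0.
  have -> : (Y ^+ 2 + Z ^+ 2) * (Q ^+ 2 + T ^+ 2) - (Y * Q + Z * T) ^+ 2 =
    (Y * T - Z * Q) ^+ 2 by ring.
  exact: sqr_ge0.
apply: le_trans (ler_norm _) _; rewrite -sqrtr_sqr ler_wsqrtr//.
have -> : (k * P * ((Num.sqrt (1 - w ^+ 2))^-1 *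
    Num.sqrt (M ^+ 2 * (1 - w ^+ 2) + m ^+ 2 * w ^+ 2))) ^+ 2 =
  k ^+ 2 * P ^+ 2 * (M ^+ 2 * (1 - w ^+ 2) + m ^+ 2 * w ^+ 2) / (1 - w ^+ 2).
  rewrite !exprMn exprVn !sqr_sqrtr ?(ltW w2)//; first
    by rewrite [_^-1 * _]mulrC !mulrA.
  by rewrite addr_ge0// mulr_ge0 ?sqr_ge0// ltW.
rewrite ler_pdivrMr// !exprMn.
have mb2 : m ^+ 2 <= b ^+ 2 by rewrite lerXn2r// nnegrE ltW.
have mc2 : m ^+ 2 <= c ^+ 2 by rewrite lerXn2r// nnegrE ltW.
have : k ^+ 2 * P ^+ 2 * w ^+ 2 <= (1 - w ^+ 2) * (Q ^+ 2 + T ^+ 2).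
  have h1 : k ^+ 2 * P ^+ 2 * w ^+ 2 = k ^+ 4 * (X * P) ^+ 2 by rewrite wE; ring.
  have h2 : k ^+ 4 * (X * P) ^+ 2 <= (X * P) ^+ 2.
    by rewrite ler_piMl ?sqr_ge0// exprn_ile1// ltW.
  have h3 : (1 - X ^+ 2) * (Q ^+ 2 + T ^+ 2) <= (1 - w ^+ 2) * (Q ^+ 2 + T ^+ 2).
    rewrite ler_wpM2r// lerD2l lerN2 wE exprMn ler_piMl ?sqr_ge0// ltW//.
  rewrite h1; lra.
have := sqr_ge0 P; have := sqr_ge0 Q; have := sqr_ge0 T; have := sqr_ge0 M.
have := sqr_ge0 m.
set k2' := k ^+ 2 in k2 *; set P2 := P ^+ 2; set Q2 := Q ^+ 2; set T2 := T ^+ 2.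
set M2 := M ^+ 2; set m2 := m ^+ 2 in mb2 mc2 *; set B2 := b ^+ 2 in mb2 *.
set C2 := c ^+ 2 in mc2 *; set V := 1 - w ^+ 2 in w2 *; set W := w ^+ 2.
move=> m20 M20 T20 Q20 P20 H.
have e1 : k2' * P2 * (M2 * V) <= M2 * P2 * V.
  have -> : k2' * P2 * (M2 * V) = k2' * (M2 * P2 * V) by ring.
  apply: ler_piMl; last exact: ltW.
  by apply: mulr_ge0; [exact: mulr_ge0 | exact: ltW].
have e2 : m2 * (k2' * P2 * W) <= m2 * (V * (Q2 + T2)) by rewrite ler_wpM2l.
have e3 : m2 * Q2 * V <= B2 * Q2 * V by rewrite !ler_wpM2r// ltW.
have e4 : m2 * T2 * V <= C2 * T2 * V by rewrite !ler_wpM2r// ltW.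
rewrite -subr_ge0.
have -> : (M2 * P2 + B2 * Q2 + C2 * T2) * V - k2' * P2 * (M2 * V + m2 * W) =
  (M2 * P2 * V - k2' * P2 * (M2 * V)) + (B2 * Q2 * V - m2 * Q2 * V)
  + (C2 * T2 * V - m2 * T2 * V) + (m2 * (V * (Q2 + T2)) - m2 * (k2' * P2 * W)) by ring.
lra.
Qed.

Lemma is_derive_coord (h : R -> 'rV[R]_3) t n : derivable h t 1 ->
  is_derive t 1 (fun t => h t ord0 n) (derive1 h t ord0 n).
Proof.
move=> dh; split; first exact: (derivable_mxP h t 1).1.
by rewrite derive1E derive_mx// mxE.
Qed.

Lemma is_derive_quadratic (x y z : R -> R) (dx dy dz A B C t : R) :
  is_derive t 1 x dx -> is_derive t 1 y dy -> is_derive t 1 z dz ->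
  is_derive t 1 (fun r => x r ^+ 2 / A + y r ^+ 2 / B + z r ^+ 2 / C)
    ((x t * dx / A + y t * dy / B + z t * dz / C) *+ 2).
Proof.
move=> Dx Dy Dz.
have -> : (fun r => x r ^+ 2 / A + y r ^+ 2 / B + z r ^+ 2 / C) =
    A^-1 *: x ^+ 2 + B^-1 *: y ^+ 2 + C^-1 *: z ^+ 2.
  by apply/funext => r; rewrite ![_ ^+ 2 / _]mulrC.
apply: is_derive_eq (is_deriveD (is_deriveD (is_deriveZ _ (is_deriveX _ Dx))
  (is_deriveZ _ (is_deriveX _ Dy))) (is_deriveZ _ (is_deriveX _ Dz))) _.
by rewrite /GRing.scale/=; ring.
Qed.

Section latitude.
Variables (M m : R) (s : R -> R).
Hypotheses (M0 : 0 < M) (m0 : 0 < m) (sP : meridian_arclength M m s).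

(** The arclength that the ellipse reaches at the coordinate [x] of its major
    axis, after the shrinking of [x / M] by [k]. *)
Definition latitude k x := s (asin (k * (x / M))).

Lemma is_derive_latitude k (x : R -> R) dx t : 0 <= k < 1 -> x t ^+ 2 <= M ^+ 2 ->
  is_derive t 1 x dx ->
  let w := k * (x t / M) in
  is_derive t 1 (latitude k \o x) (k * (dx / M) * ((Num.sqrt (1 - w ^+ 2))^-1 *
    Num.sqrt (M ^+ 2 * (1 - w ^+ 2) + m ^+ 2 * w ^+ 2))).
Proof.
move=> /andP[k0 k1] xM dxt w.
have w1 : -1 < w < 1.
  rewrite -ltr_norml normrM ger0_norm//.
  have : `|x t / M| <= 1.
    rewrite normrM normfV (gtr0_norm M0) ler_pdivrMr// mul1r.
    by rewrite -(gtr0_norm M0) -ler_sqr ?nnegrE ?normr_ge0// !real_normK ?num_real.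
  by move=> ?; rewrite (le_lt_trans _ k1)// ler_piMr.
have w1' : -1 <= w <= 1 by case/andP: w1 => ? ?; rewrite !ltW.
have d1 : is_derive t 1 (fun t => k * (x t / M)) (k * (dx / M)).
  suff : is_derive t 1 (k *: (M^-1 *: x)) (k * (dx / M)).
    by congr (is_derive _ _ _ _); apply/funext => u; rewrite fctE/= [x u / M]mulrC.
  by apply: is_derive_eq; rewrite /GRing.scale/= [dx / M]mulrC.
have d2 := is_derive1_asin w1.
have d3 : is_derive (asin w) 1 s (meridian_speed M m (asin w)).
  apply: sP.2; rewrite in_itv/=; have := asin_geNpi2 w1'; have := asin_lepi2 w1'.
  by have := @pihalf_lt2 R => ? ? ?; apply/andP; split; lra.
have d23 := is_derive1_comp d3 d2.
have d4 := @is_derive1_comp R (s \o asin) (fun t => k * (x t / M)) t _ _ d23 d1.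
apply: is_derive_eq d4 _.
rewrite /meridian_speed cos_asin// asinK ?in_itv//= sqr_sqrtr//.
  by rewrite mulrC; congr (_ * _); rewrite mulrC.
rewrite subr_ge0 -real_normK ?num_real// expr_le1// ler_norml//.
Qed.

Section long_axis.
(** The axes are listed as [i], [j], [l], the one of semi-axis [M] first. *)
Variables (b c : R) (i j l : 'I_3) (S : set 'rV[R]_3).
Hypotheses (mb : m <= b) (mc : m <= c).
Hypothesis enormE : forall v : 'rV[R]_3,
  enorm v = Num.sqrt (v ord0 i ^+ 2 + v ord0 j ^+ 2 + v ord0 l ^+ 2).
Hypothesis SE : forall v : 'rV[R]_3, S v ->
  v ord0 i ^+ 2 / M ^+ 2 + v ord0 j ^+ 2 / b ^+ 2 + v ord0 l ^+ 2 / c ^+ 2 = 1.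

Lemma ellipsoid_tangent (h : R -> 'rV[R]_3) u v t : t \in `]u, v[ ->
  derivable h t 1 -> (forall r, r \in `[u, v] -> S (h r)) ->
  h t ord0 i * derive1 h t ord0 i / M ^+ 2 +
  h t ord0 j * derive1 h t ord0 j / b ^+ 2 +
  h t ord0 l * derive1 h t ord0 l / c ^+ 2 = 0.
Proof.
move=> tuv dh hS.
pose q r := h r ord0 i ^+ 2 / M ^+ 2 + h r ord0 j ^+ 2 / b ^+ 2
            + h r ord0 l ^+ 2 / c ^+ 2.
have dq1 : is_derive t 1 q 0.
  have d1 : is_derive t 1 (cst 1 : R -> R) 0 by exact: is_derive_cst.
  apply: near_eq_is_derive d1.
  near=> r; apply/esym/SE/hS/subset_itv_oo_cc; near: r; exact: near_in_itvoo.
have di := is_derive_coord i dh; have dj := is_derive_coord j dh.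
have dl := is_derive_coord l dh.
have dq2 := is_derive_quadratic (M ^+ 2) (b ^+ 2) (c ^+ 2) di dj dl.
have := @derive_val _ _ _ _ _ _ _ dq2.
rewrite (@derive_val _ _ _ _ _ _ _ dq1) => /esym/eqP.
by rewrite mulrn_eq0/= => /eqP.
Unshelve. all: by end_near. Qed.

Lemma le_piece_length k (h : R -> 'rV[R]_3) u v : 0 <= k < 1 -> u < v ->
  (forall t, derivable h t 1) -> continuous (derive1 h) ->
  (forall t, t \in `[u, v] -> S (h t)) ->
  ((latitude k (h v ord0 i) - latitude k (h u ord0 i))%:E
    <= \int[mu]_(t in `[u, v]) (enorm (derive1 h t))%:E)%E.
Proof.
move=> k01 uv dh ch hS.
apply: (@derive_le_integral _ _ (fun t => latitude k (h t ord0 i)) _ u v uv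
  (continuous_speed ch)).
- move=> t tuv; apply: (is_derive_latitude (x := fun t => h t ord0 i)) => //.
    rewrite -[leRHS]mul1r -ler_pdivrMr ?exprn_gt0// -(SE (hS _ tuv)) -addrA.
    by rewrite lerDl addr_ge0// divr_ge0// sqr_ge0.
  exact: is_derive_coord.
- move=> t tuv; rewrite enormE; apply: (latitude_speed_le M0 m0 mb mc k01) => //.
  + exact/SE/hS/subset_itv_oo_cc.
  + exact: (ellipsoid_tangent tuv).
Qed.

Lemma le_latitude_curve_length k g p q : 0 <= k < 1 -> curves S p q g ->
  ((latitude k (q ord0 i) - latitude k (p ord0 i))%:E <= curve_length g)%E.
Proof.
move=> k01 [gC1 <- <- gS].
apply: (@le_curve_length _ g (fun t => latitude k (g t ord0 i)) gC1).
move=> u v h u0 uv v1 dh ch gh.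
have uuv : u \in `[u, v] by rewrite in_itv/= lexx ltW.
have vuv : v \in `[u, v] by rewrite in_itv/= lexx ltW.
rewrite (gh u uuv) (gh v vuv).
apply: (le_piece_length k01 uv dh ch) => t tuv; rewrite -gh//; apply: gS.
move: tuv; rewrite !in_itv/= => /andP[ut tv].
by rewrite (le_trans u0 ut) (le_trans tv v1).
Qed.

Lemma latitude_pole x : 0 < x < pi / 2 -> latitude (sin x) M = s x.
Proof.
move=> /andP[x0 x2]; rewrite /latitude divff ?gt_eqF// mulr1 sinK// in_itv/=.
by apply/andP; split; lra.
Qed.

Lemma latitude_poleN x : 0 < x < pi / 2 -> latitude (sin x) (- M) = - s x.
Proof.
move=> /andP[x0 x2]; rewrite /latitude mulNr divff ?gt_eqF// mulrN1 -sinN.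
rewrite sinK ?in_itv/=; last by apply/andP; split; lra.
by rewrite (arclengthN sP)// in_itv/= !ltW.
Qed.

(** For [k := sin x] the ends of the axis are assigned the arclengths of the
    parameters [- x] and [x]; the bound follows as [x] tends to [pi / 2]. *)
Lemma le_antipodal_curve_length g p q : p ord0 i = - M -> q ord0 i = M ->
  curves S p q g -> ((s (pi / 2) *+ 2)%:E <= curve_length g)%E.
Proof.
move=> pM qM gpq.
have H (x : R) : 0 < x < pi / 2 -> ((s x *+ 2)%:E <= curve_length g)%E.
  move=> xpi; have /andP[x0 x2] := xpi.
  have k01 : 0 <= sin x < 1.
    apply/andP; split.
      by apply: sin_ge0_pi; have := @pi_gt0 R => ?; apply/andP; split; lra.
    by rewrite -sin_pihalf ltr_sin ?in_itv/=//; apply/andP; split; lra.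
  have := le_latitude_curve_length k01 gpq.
  by rewrite pM qM latitude_pole// latitude_poleN// opprK -mulr2n.
have pi0 : 0 < pi / 2 :> R by rewrite divr_gt0// pi_gt0.
have : s x *+ 2 @[x --> (pi / 2)^'-] --> s (pi / 2) *+ 2.
  apply: cvg_at_left_filter.
  have cs : {for pi / 2, continuous s}.
    apply: is_derive_continuous (sP.2 _ _); rewrite in_itv/=.
    by have := @pihalf_lt2 R => ?; apply/andP; split; lra.
  rewrite mulr2n; under eq_fun do rewrite mulr2n.
  exact: (cvgD cs cs).
case: (curve_length g) H => [r| |] H sl; last 2 first.
- by rewrite leey.
- have p4 : 0 < (pi : R) / 4 < pi / 2 by apply/andP; split; lra.
  by have := H _ p4; rewrite leNgt ltNyr.
rewrite lee_fin; apply: cvgr_to_le sl _.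
near=> x; rewrite -lee_fin; apply: H; apply/andP; split.
- by near: x; exact: nbhs_left_gt.
- by near: x; exact: nbhs_left_lt.
Unshelve. all: by end_near. Qed.

Lemma le_antipodal_diameter p q : S p -> S q -> p ord0 i = - M -> q ord0 i = M ->
  ((s (pi / 2) *+ 2)%:E <= intrinsic_diameter S)%E.
Proof.
move=> Sp Sq pM qM; apply: (@le_trans _ _ (geodesic_dist S p q)).
  by apply: le_ereal_inf_tmp => _ [g gpq <-]; exact: le_antipodal_curve_length gpq.
by apply: ereal_sup_ubound; exists p => //; exists q.
Qed.

End long_axis.
End latitude.

Lemma le_ellipsoid_diameter (a b c M m : R) s : 0 < m -> m <= a -> m <= b -> m <= c ->
  [\/ M = a, M = b | M = c] -> meridian_arclength M m s ->
  ((s (pi / 2) *+ 2)%:E <= intrinsic_diameter (ellipsoid a b c))%E.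
Proof.
move=> m0 ma mb mc Mabc sP.
have a0 := lt_le_trans m0 ma; have b0 := lt_le_trans m0 mb.
have c0 := lt_le_trans m0 mc.
have mxE3 (x y z : R) : [/\ vec3 x y z ord0 0 = x, vec3 x y z ord0 1 = y &
  vec3 x y z ord0 2 = z] by rewrite /vec3 !mxE.
have vecS (x y z : R) : x ^+ 2 / a ^+ 2 + y ^+ 2 / b ^+ 2 + z ^+ 2 / c ^+ 2 = 1 ->
    ellipsoid a b c (vec3 x y z).
  by rewrite /ellipsoid/=; have [-> -> ->] := mxE3 x y z.
have unit (x : R) : 0 < x -> x ^+ 2 / x ^+ 2 = 1.
  by move=> x0; rewrite divff// gt_eqF// exprn_gt0.
case: Mabc sP => -> sP.
- apply: (@le_antipodal_diameter _ _ _ a0 m0 sP _ _ 0 1 2 _ mb mc _ _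
    (vec3 (- a) 0 0) (vec3 a 0 0)) => [v|v||||].
  + exact: enorm3.
  + by [].
  + by apply: vecS; rewrite sqrrN unit// expr0n !mul0r !addr0.
  + by apply: vecS; rewrite unit// expr0n !mul0r !addr0.
  + by have [] := mxE3 (- a) 0 0.
  + by have [] := mxE3 a 0 0.
- apply: (@le_antipodal_diameter _ _ _ b0 m0 sP _ _ 1 0 2 _ ma mc _ _
    (vec3 0 (- b) 0) (vec3 0 b 0)) => [v|v||||].
  + by rewrite enorm3 [_ + v ord0 1 ^+ 2]addrC.
  + by move=> <-; rewrite [_ + v ord0 0 ^+ 2 / _]addrC.
  + by apply: vecS; rewrite sqrrN unit// expr0n !mul0r addr0 add0r.
  + by apply: vecS; rewrite unit// expr0n !mul0r addr0 add0r.
  + by have [] := mxE3 0 (- b) 0.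
  + by have [] := mxE3 0 b 0.
- apply: (@le_antipodal_diameter _ _ _ c0 m0 sP _ _ 2 0 1 _ ma mb _ _
    (vec3 0 0 (- c)) (vec3 0 0 c)) => [v|v||||].
  + by rewrite enorm3; congr Num.sqrt; ring.
  + by move=> <-; ring.
  + by apply: vecS; rewrite sqrrN unit// expr0n !mul0r !add0r.
  + by apply: vecS; rewrite unit// expr0n !mul0r !add0r.
  + by have [] := mxE3 0 0 (- c).
  + by have [] := mxE3 0 0 c.
Qed.

End Diameter.

(** * Moments of the coordinates on the unit sphere *)

Section Moments.
Context {R : realType}.
Implicit Types (f g u v F : R -> R) (a b I : R) (w : R * R) (n : 'I_3).

Local Notation mu := (@lebesgue_measure R).

Lemma integral_rectangle f g (A B : set R) : measurable A -> measurable B ->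
  measurable_fun setT f -> measurable_fun setT g ->
  (forall x, A x -> 0 <= f x) -> (forall y, B y -> 0 <= g y) ->
  (\int[mu \x mu]_(w in A `*` B) (f w.1 * g w.2)%:E =
   \int[mu]_(x in A) (f x)%:E * \int[mu]_(y in B) (g y)%:E)%E.
Proof.
move=> mA mB mf mg f0 g0.
have fA0 x : 0 <= (f \_ A) x.
  by rewrite patchE; case: ifPn => // /set_mem /f0.
have gB0 x : 0 <= (g \_ B) x.
  by rewrite patchE; case: ifPn => // /set_mem /g0.
have mfA : measurable_fun setT (f \_ A).
  by apply/(measurable_restrictT _ _).1 => //; exact: measurable_funS mf.
have mgB : measurable_fun setT (g \_ B).
  by apply/(measurable_restrictT _ _).1 => //; exact: measurable_funS mg.
rewrite [LHS]integral_mkcond [X in (X * _)%E]integral_mkcond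
  [X in (_ * X)%E]integral_mkcond.
have -> : (fun w => (f w.1 * g w.2)%:E) \_ (A `*` B) =
    (fun w => ((f \_ A) w.1 * (g \_ B) w.2)%:E).
  apply/funext => -[x y]; rewrite !patchE/= in_setX/=.
  by case: (x \in A); case: (y \in B); rewrite /= ?mul0r ?mulr0.
have -> : (fun x => (f x)%:E) \_ A = (EFin \o (f \_ A)) by rewrite restrict_EFin.
have -> : (fun x => (g x)%:E) \_ B = (EFin \o (g \_ B)) by rewrite restrict_EFin.
have mfst : measurable_fun setT (fun w => (f \_ A) w.1).
  exact: measurableT_comp mfA measurable_fst.
have msnd : measurable_fun setT (fun w => (g \_ B) w.2).
  exact: measurableT_comp mgB measurable_snd.
rewrite fubini_tonelli1/=; last 2 first.
- by apply/measurable_EFinP; exact: measurable_funM mfst msnd.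
- by move=> [x y]; rewrite lee_fin mulr_ge0.
rewrite -[RHS]muleC -ge0_integralZl//; last 3 first.
- exact/measurable_EFinP.
- by move=> x _; rewrite lee_fin.
- by apply: integral_ge0 => x _; rewrite lee_fin.
apply: eq_integral => x _; rewrite muleC /fubini_F/=.
under eq_integral do rewrite EFinM.
rewrite ge0_integralZl//.
- exact/measurable_EFinP.
- by move=> y _; rewrite lee_fin.
- by rewrite lee_fin.
Qed.

Lemma integral_oo_derive f F a b : a < b -> continuous f ->
  antiderivative_on `[a, b] F f ->
  (\int[mu]_(x in `]a, b[) (f x)%:E = (F b - F a)%:E)%E.
Proof.
move=> ab cf dF; rewrite -(integral_derive ab cf dF).
rewrite -(@integral_itv_bndoo _ a b (EFin \o f) true false)//.
apply/measurable_EFinP.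
exact: measurable_funS (continuous_measurable_fun cf).
Qed.

(** Unlike an integral, it can be reduced from one power to the next without
    continuity or measurability conditions. *)
Definition primitive_increment f a b I :=
  exists2 F : R -> R, (forall x : R, is_derive x 1 F (f x)) & F b - F a = I.

Lemma integral_primitive_increment f a b I : a < b -> continuous f ->
  primitive_increment f a b I ->
  (\int[mu]_(x in `]a, b[) (f x)%:E = I%:E)%E.
Proof.
move=> ab cf [F dF <-]; apply: integral_oo_derive => // x _; exact: dF.
Qed.

(** Integration by parts: [u * v ^+ k.+1] is an antiderivative of
    [k.+2 * v ^+ k.+2 - k.+1 * v ^+ k]. *)
Lemma primitive_increment_pow u v a b k I :
  (forall x : R, is_derive x 1 u (v x)) -> (forall x : R, is_derive x 1 v (- u x)) ->
  (forall x, u x ^+ 2 + v x ^+ 2 = 1) -> u a * v a = 0 -> u b * v b = 0 ->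
  primitive_increment (fun x => v x ^+ k) a b I ->
  primitive_increment (fun x => v x ^+ k.+2) a b (k.+1%:R / k.+2%:R * I).
Proof.
move=> du dv uv ua ub [F dF FI].
exists (k.+2%:R^-1 *: (u * v ^+ k.+1 + k.+1%:R *: F)).
  move=> x; have dvk := @is_deriveX _ _ _ k.+1 _ _ _ (dv x).
  apply: is_derive_eq (is_deriveZ _ (is_deriveD (is_deriveM (du x) dvk)
    (is_deriveZ _ (dF x)))) _.
  have v2 : v x ^+ k.+2 = v x ^+ k * v x ^+ 2 by rewrite -exprD addn2.
  rewrite /GRing.scale/= fctE v2 exprS.
  have -> : u x * (k.+1%:R * v x ^+ k * - u x) = - k.+1%:R * v x ^+ k * u x ^+ 2.
    by ring.
  have -> : u x ^+ 2 = 1 - v x ^+ 2 by rewrite -(uv x); ring.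
  have k0 : k.+2%:R != 0 :> R by rewrite pnatr_eq0.
  have -> : k.+1%:R = k.+2%:R - 1 :> R by rewrite -[in RHS]natr1 addrK.
  by field.
rewrite !fctE /GRing.scale/= !exprS.
rewrite !mulrA ua ub !mul0r !add0r -FI; ring.
Qed.

Definition wallis_even k : R := \prod_(i < k) (i.*2.+1%:R / i.*2.+2%:R).
Definition wallis_odd k : R := \prod_(i < k) (i.*2.+2%:R / i.*2.+3%:R).

(** [wallis_even k] is the mean of [cos ^+ k.*2] over a period, and [wallis_odd k]
    is half of the integral of [sin ^+ k.*2.+1] from 0 to [pi]. *)
Lemma wallis_mul k : wallis_even k * wallis_odd k = k.*2.+1%:R^-1.
Proof.
elim: k => [|k IH]; first by rewrite /wallis_even /wallis_odd !big_ord0 mulr1 invr1.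
rewrite /wallis_even /wallis_odd !big_ord_recr/= mulrACA -/(wallis_even k).
rewrite -/(wallis_odd k) IH doubleS; set x := k.*2.
by field; rewrite -!natrD nat1r !pnatr_eq0.
Qed.

Let is_derive_Ncos (x : R) : is_derive x 1 (- (@cos R)) (sin x).
Proof. by apply: is_derive_eq; rewrite opprK. Qed.

Lemma primitive_increment_even u v a b k :
  (forall x : R, is_derive x 1 u (v x)) -> (forall x : R, is_derive x 1 v (- u x)) ->
  (forall x, u x ^+ 2 + v x ^+ 2 = 1) -> u a * v a = 0 -> u b * v b = 0 ->
  primitive_increment (fun x => v x ^+ k.*2) a b (wallis_even k * (b - a)).
Proof.
move=> du dv uv ua ub; elim: k => [|k IH].
  exists id; last by rewrite /wallis_even big_ord0 mul1r.
  by move=> x; exact: is_derive_id.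
have -> : wallis_even k.+1 * (b - a) =
    k.*2.+1%:R / k.*2.+2%:R * (wallis_even k * (b - a)).
  by rewrite /wallis_even big_ord_recr/=; ring.
by rewrite doubleS; exact: primitive_increment_pow IH.
Qed.

Lemma primitive_increment_cos_even k :
  primitive_increment (fun x => cos x ^+ k.*2) 0 (2 * pi) (wallis_even k * (2 * pi)).
Proof.
have := @primitive_increment_even sin cos 0 (2 * pi) k; rewrite subr0; apply.
- by move=> x; rewrite addrC cos2Dsin2.
- by rewrite sin0 mul0r.
- by rewrite mulr_natl sin2pi mul0r.
Qed.

Lemma primitive_increment_sin_even k :
  primitive_increment (fun x => sin x ^+ k.*2) 0 (2 * pi) (wallis_even k * (2 * pi)).
Proof.
have := @primitive_increment_even (- cos) sin 0 (2 * pi) k; rewrite subr0; apply.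
- exact: is_derive_Ncos.
- by move=> x; rewrite opprK; exact: is_derive_sin.
- by move=> x; rewrite sqrrN cos2Dsin2.
- by rewrite sin0 mulr0.
- by rewrite mulr_natl sin2pi mulr0.
Qed.

Lemma primitive_increment_sin_odd k :
  primitive_increment (fun x => sin x ^+ k.*2.+1) 0 pi (wallis_odd k * 2).
Proof.
elim: k => [|k IH].
  exists (- cos) => [x|]; first by rewrite expr1.
  by rewrite /wallis_odd big_ord0 mul1r !fctE/= cospi cos0; ring.
have -> : wallis_odd k.+1 * 2 = k.*2.+2%:R / k.*2.+3%:R * (wallis_odd k * 2).
  by rewrite /wallis_odd big_ord_recr/=; ring.
rewrite doubleS; apply: (@primitive_increment_pow (- cos) sin) => //.
- by move=> x; rewrite opprK; exact: is_derive_sin.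
- by move=> x; rewrite sqrrN cos2Dsin2.
- by rewrite sin0 mulr0.
- by rewrite sinpi mulr0.
Qed.

Lemma primitive_increment_sin_cos k :
  primitive_increment (fun x => sin x * cos x ^+ k.*2) 0 pi (2 / k.*2.+1%:R).
Proof.
have k0 : k.*2.+1%:R != 0 :> R by rewrite pnatr_eq0.
exists (- k.*2.+1%:R^-1 *: cos ^+ k.*2.+1).
  move=> x; apply: is_derive_eq; rewrite /GRing.scale/=; by field.
rewrite !fctE/= /GRing.scale/= cospi cos0 expr1n -signr_odd/= odd_double/=.
by rewrite expr1; field.
Qed.

Definition sphere n w : R := ellipsoid_chart 1 1 1 w ord0 n.

Lemma sphere0E w : sphere 0 w = sin w.1 * cos w.2.
Proof. by rewrite /sphere !mxE/= mul1r. Qed.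

Lemma sphere1E w : sphere 1 w = sin w.1 * sin w.2.
Proof. by rewrite /sphere !mxE/= mul1r. Qed.

Lemma sphere2E w : sphere 2 w = cos w.1.
Proof. by rewrite /sphere !mxE/= mul1r. Qed.

Lemma ord3P n : [\/ n = 0, n = 1 | n = 2].
Proof.
by case: n => [[|[|[|//]]] ?]; [apply: Or31|apply: Or32|apply: Or33]; exact/val_inj.
Qed.

Definition angles : set (R * R) := `]0, pi[%classic `*` `]0, 2 * pi[%classic.

Let pi20 : 0 < 2 * pi :> R.
Proof. by rewrite mulr_gt0// pi_gt0. Qed.

Let cX k v : continuous v -> continuous (fun x => v x ^+ k).
Proof. by move=> cv x; apply: cvgX; exact: cv. Qed.

(** By Archimedes' theorem each coordinate is uniformly distributed on the interval
    from -1 to 1, hence the value. For the first two coordinates the integral is a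
    product, to which [wallis_mul] applies. *)
Lemma sphere_moment n k :
  (\int[mu \x mu]_(w in angles) (sin w.1 * (sphere n w ^+ 2) ^+ k)%:E =
   (4 * pi / k.*2.+1%:R)%:E)%E.
Proof.
have msin j : measurable_fun setT (fun x : R => sin x ^+ j).
  exact: continuous_measurable_fun (@cX j sin (@continuous_sin R)).
have mcos j : measurable_fun setT (fun x : R => cos x ^+ j).
  exact: continuous_measurable_fun (@cX j cos (@continuous_cos R)).
have sin_ge0 j x : `]0, pi[%classic x -> 0 <= sin x ^+ j :> R.
  rewrite /= in_itv/= => /andP[x0 xpi]; apply: exprn_ge0.
  by apply: sin_ge0_pi; rewrite !ltW.
have even_ge0 (v : R -> R) x : 0 <= v x ^+ k.*2.
  by rewrite -mul2n exprM exprn_ge0// sqr_ge0.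
have val : wallis_odd k * 2 * (wallis_even k * (2 * pi)) = 4 * pi / k.*2.+1%:R.
  by rewrite -wallis_mul; ring.
case: (ord3P n) => ->.
- under eq_integral => w _.
    rewrite sphere0E -exprM mul2n exprMn mulrA -exprS; over.
  rewrite (@integral_rectangle (fun x => sin x ^+ k.*2.+1) (fun y => cos y ^+ k.*2))//.
    rewrite (integral_primitive_increment (pi_gt0 R) _
      (primitive_increment_sin_odd k)).
      rewrite (integral_primitive_increment pi20 _
        (primitive_increment_cos_even k)) -?EFinM ?val//.
      exact: cX (@continuous_cos R).
    exact: cX (@continuous_sin R).
  by move=> x; exact: sin_ge0.
- under eq_integral => w _.
    rewrite sphere1E -exprM mul2n exprMn mulrA -exprS; over.
  rewrite (@integral_rectangle (fun x => sin x ^+ k.*2.+1) (fun y => sin y ^+ k.*2))//.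
    rewrite (integral_primitive_increment (pi_gt0 R) _
      (primitive_increment_sin_odd k)).
      rewrite (integral_primitive_increment pi20 _
        (primitive_increment_sin_even k)) -?EFinM ?val//.
      exact: cX (@continuous_sin R).
    exact: cX (@continuous_sin R).
  by move=> x; exact: sin_ge0.
- under eq_integral => w _.
    rewrite sphere2E -exprM mul2n -[_ * _]mulr1; over.
  rewrite (@integral_rectangle (fun x => sin x * cos x ^+ k.*2) (cst 1))//.
  + have csc : continuous (fun x : R => sin x * cos x ^+ k.*2).
      by move=> x; apply: cvgM; [exact: continuous_sin|exact: cX (@continuous_cos R) x].
    rewrite (integral_primitive_increment (pi_gt0 R) csc (primitive_increment_sin_cos k)).
    rewrite (@integral_primitive_increment _ _ _ (2 * pi) pi20).
    * by rewrite -EFinM; congr EFin; ring.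
    * exact: cst_continuous.
    * exists id; last by rewrite subr0.
      by move=> x; exact: is_derive_id.
  + have := measurable_funM (msin 1%N) (mcos k.*2).
    by congr measurable_fun; apply/funext => x; rewrite /= expr1.
  + by move=> x /(sin_ge0 1%N); rewrite expr1 => ?; rewrite mulr_ge0.
Qed.

End Moments.

(** * Functions of one coordinate on the unit sphere *)

Section HatBox.
Context {R : realType}.
Implicit Types (f g : R -> R) (P : {poly R}) (w : R * R) (n : 'I_3).

Local Notation mu := (@lebesgue_measure R).

Lemma measurable_angles : measurable (@angles R).
Proof. exact: measurableX. Qed.
#[local] Hint Resolve measurable_angles : core.

Lemma measurable_fun_sin1 : measurable_fun setT (fun w => sin w.1 : R).
Proof.
apply: measurableT_comp measurable_fst.
exact: continuous_measurable_fun (@continuous_sin R).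
Qed.

Lemma measurable_fun_cos1 : measurable_fun setT (fun w => cos w.1 : R).
Proof.
apply: measurableT_comp measurable_fst.
exact: continuous_measurable_fun (@continuous_cos R).
Qed.

Lemma measurable_fun_sphere n : measurable_fun setT (sphere n : R * R -> R).
Proof.
have mc2 : measurable_fun setT (fun w => cos w.2 : R).
  apply: measurableT_comp measurable_snd.
  exact: continuous_measurable_fun (@continuous_cos R).
have ms2 : measurable_fun setT (fun w => sin w.2 : R).
  apply: measurableT_comp measurable_snd.
  exact: continuous_measurable_fun (@continuous_sin R).
case: (ord3P n) => ->.
- have -> : sphere 0 = (fun w => sin w.1 * cos w.2 : R).
    by apply/funext => w; rewrite sphere0E.
  exact: measurable_funM measurable_fun_sin1 mc2.
- have -> : sphere 1 = (fun w => sin w.1 * sin w.2 : R).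
    by apply/funext => w; rewrite sphere1E.
  exact: measurable_funM measurable_fun_sin1 ms2.
- have -> : sphere 2 = (fun w => cos w.1 : R).
    by apply/funext => w; rewrite sphere2E.
  exact: measurable_fun_cos1.
Qed.

Lemma measurable_fun_axial n f : measurable_fun setT f ->
  measurable_fun setT (fun w => sin w.1 * f (sphere n w ^+ 2) : R).
Proof.
move=> mf; have m2 : measurable_fun setT (fun w => sphere n w ^+ 2 : R).
  have := measurable_funM (measurable_fun_sphere n) (measurable_fun_sphere n).
  by congr measurable_fun; apply/funext => w; rewrite /= expr2.
exact: measurable_funM measurable_fun_sin1 (measurableT_comp mf m2).
Qed.

Lemma sphere_sqr w : sphere 0 w ^+ 2 + sphere 1 w ^+ 2 + sphere 2 w ^+ 2 = 1 :> R.
Proof.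
rewrite sphere0E sphere1E sphere2E !exprMn -mulrDr cos2Dsin2 mulr1.
by rewrite addrC cos2Dsin2.
Qed.

Lemma sphere_sqr_itv n w : 0 <= (sphere n w : R) ^+ 2 <= 1.
Proof.
rewrite sqr_ge0/= -(sphere_sqr w).
have := sqr_ge0 (sphere 0 w); have := sqr_ge0 (sphere 1 w).
have := sqr_ge0 (sphere 2 w).
by case: (ord3P n) => -> *; lra.
Qed.

Lemma sin_ge0_angles w : angles w -> 0 <= sin w.1 :> R.
Proof.
move=> [/= + _]; rewrite in_itv/= => /andP[x0 xpi].
by apply: sin_ge0_pi; rewrite !ltW.
Qed.

Definition sphere_poly_integral P : R :=
  \sum_(k < size P) P`_k * (4 * pi / k.*2.+1%:R).

Lemma integral_sphere_poly n P :
  (\int[mu \x mu]_(w in angles) (sin w.1 * P.[sphere n w ^+ 2])%:E =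
   (sphere_poly_integral P)%:E)%E.
Proof.
have mono_int k : (mu \x mu)%E.-integrable angles
    (fun w => (sin w.1 * (sphere n w ^+ 2) ^+ k)%:E).
  apply/integrableP; split.
    have mk : measurable_fun setT (fun x : R => x ^+ k).
      by have := continuous_measurable_fun (@exprn_continuous R k).
    apply/measurable_EFinP.
    by apply: measurable_funS (measurable_fun_axial n mk).
  have -> : (\int[mu \x mu]_(w in angles) `|(sin w.1 * (sphere n w ^+ 2) ^+ k)%:E|
      = (4 * pi / k.*2.+1%:R)%:E)%E; last exact: ltry.
  rewrite -(sphere_moment n k); apply: eq_integral => w /set_mem wU.
  rewrite gee0_abs// lee_fin; apply: mulr_ge0; first exact: sin_ge0_angles.
  exact/exprn_ge0/sqr_ge0.
transitivity (\int[mu \x mu]_(w in angles) (\sum_(k < size P)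
    ((P`_k)%:E * (sin w.1 * (sphere n w ^+ 2) ^+ k)%:E))%E)%E.
  apply: eq_integral => w _; rewrite horner_coef mulr_sumr -sumEFin.
  by apply: eq_bigr => k _; rewrite -EFinM; congr EFin; ring.
rewrite integral_sum//; last by move=> k; exact: integrableZl.
rewrite -sumEFin; apply: eq_bigr => k _.
by rewrite integralZl// sphere_moment -EFinM.
Qed.

Definition uniform_poly_limit g :=
  forall e, 0 < e -> exists P, {in `[0, 1], forall x, `|g x - P.[x]| <= e}.

(** The integrals of polynomials in the square of a coordinate do not depend on
    the coordinate, so neither do those of their uniform limits. *)
Lemma integral_sphere_le n n' g : measurable_fun setT g ->
  {in `[0, 1], forall x, 0 <= g x} -> uniform_poly_limit g ->
  (\int[mu \x mu]_(w in angles) (sin w.1 * g (sphere n w ^+ 2))%:E <=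
   \int[mu \x mu]_(w in angles) (sin w.1 * g (sphere n' w ^+ 2))%:E)%E.
Proof.
move=> mg g0 gP; apply/lee_addgt0Pr => e e0.
have d0 : 0 < e / (8 * pi) by rewrite divr_gt0// mulr_gt0// pi_gt0.
have [P gPe] := gP _ d0; set d := e / (8 * pi) in d0 gPe.
have inI j w : sphere j w ^+ 2 \in `[0, 1] by rewrite in_itv/= sphere_sqr_itv.
have mP (Q : {poly R}) : measurable_fun setT (fun x => Q.[x]).
  by apply: continuous_measurable_fun => x; exact: continuous_horner.
have mE j f : measurable_fun setT f -> measurable_fun angles
    (fun w => (sin w.1 * f (sphere j w ^+ 2))%:E).
  move=> mf; apply/measurable_EFinP.
  by apply: measurable_funS (measurable_fun_axial j mf).
pose Q := P + d%:P.
have gQ x : x \in `[0, 1] -> g x <= Q.[x] <= g x + d *+ 2.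
  move=> /gPe; rewrite ler_norml /Q hornerD hornerC => /andP[? ?].
  by apply/andP; split; lra.
have sg0 j f : {in `[0, 1], forall x, 0 <= f x} ->
    forall w, angles w -> (0 <= (sin w.1 * f (sphere j w ^+ 2))%:E)%E.
  by move=> f0 w wU; rewrite lee_fin mulr_ge0 ?sin_ge0_angles ?f0.
have Q0 : {in `[0, 1], forall x, 0 <= Q.[x]}.
  by move=> x x01; have /andP[+ _] := gQ x x01; apply: le_trans; exact: g0.
apply: (@le_trans _ _ (\int[mu \x mu]_(w in angles)
    (sin w.1 * Q.[sphere n w ^+ 2])%:E)%E).
  apply: ge0_le_integral => //.
  - exact: sg0.
  - exact: mE.
  - exact: (mE _ (fun x => Q.[x])).
  - move=> w wU; rewrite lee_fin ler_wpM2l ?sin_ge0_angles//.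
    by have /andP[] := gQ _ (inI n w).
rewrite integral_sphere_poly -(integral_sphere_poly n').
apply: (@le_trans _ _ (\int[mu \x mu]_(w in angles)
    ((sin w.1 * g (sphere n' w ^+ 2))%:E +
     (sin w.1 * (d *+ 2)%:P.[sphere n' w ^+ 2])%:E))%E).
  apply: ge0_le_integral => //.
  - exact: (sg0 _ (fun x => Q.[x])).
  - exact: (mE _ (fun x => Q.[x])).
  - by apply: emeasurable_funD; [exact: mE|exact: (mE _ (fun x => _.[x]))].
  - move=> w wU; rewrite -EFinD lee_fin -mulrDr hornerC.
    rewrite ler_wpM2l ?sin_ge0_angles//.
    by have /andP[] := gQ _ (inI n' w).
rewrite ge0_integralD//; first last.
- exact: (mE _ (fun x => _.[x])).
- apply: (sg0 _ (fun x => _.[x])) => x _.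
  by rewrite hornerC mulrn_wge0// ltW.
- exact: mE.
- exact: sg0.
rewrite integral_sphere_poly; apply: leeD => //.
rewrite lee_fin /sphere_poly_integral.
have dn0 : d *+ 2 != 0 by rewrite mulrn_eq0/= gt_eqF.
rewrite size_polyC dn0 big_ord1 coefC/= divr1 /d.
suff -> : e / (8 * pi) *+ 2 * (4 * pi) = e by exact: lexx.
move: (@pi_gt0 R); move: (@pi R) => p p0; by field; rewrite gt_eqF.
Qed.

End HatBox.

(** * The area density of an ellipsoid *)

Section Area.
Context {R : realType}.
Implicit Types (a b c m M : R) (w : R * R) (n : 'I_3).

Local Notation mu := (@lebesgue_measure R).

Lemma derive1_vec3 (x y z : R -> R) (t dx dy dz : R) :
  is_derive t 1 x dx -> is_derive t 1 y dy -> is_derive t 1 z dz ->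
  derive1 (fun r => vec3 (x r) (y r) (z r)) t = vec3 dx dy dz.
Proof.
move=> Dx Dy Dz; pose f n := [:: x; y; z]`_n; pose df n := [:: dx; dy; dz]`_n.
have Dn (n : 'I_3) : is_derive t 1 (fun r => vec3 (x r) (y r) (z r) ord0 n) (df n).
  have -> : (fun r => vec3 (x r) (y r) (z r) ord0 n) = f n.
    by apply/funext => r; rewrite mxE /f; case: n => [[|[|[|]]]].
  by case: n => [[|[|[|//]]] ?]; [exact: Dx|exact: Dy|exact: Dz].
have dvec : derivable (fun r => vec3 (x r) (y r) (z r)) t 1.
  by apply/derivable_mxP => i n; rewrite (ord1 i); have [] := Dn n.
rewrite derive1E derive_mx//; apply/matrixP => i n; rewrite (ord1 i) !mxE.
by rewrite (@derive_val _ _ _ _ _ _ _ (Dn n)).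
Qed.

Lemma is_derive_mull (k t d : R) (f : R -> R) :
  is_derive t 1 f d -> is_derive t 1 (fun x => k * f x) (k * d).
Proof. exact: is_deriveZ. Qed.

Lemma dot_vec3 (x y z x' y' z' : R) :
  dot (vec3 x y z) (vec3 x' y' z') = x * x' + y * y' + z * z'.
Proof. by rewrite /dot !big_ord_recl big_ord0 !mxE/= addr0 addrA. Qed.

Lemma area_densityE a b c w :
  let r1 := derive1 (fun x => ellipsoid_chart a b c (x, w.2)) w.1 in
  let r2 := derive1 (fun x => ellipsoid_chart a b c (w.1, x)) w.2 in
  dot r1 r1 * dot r2 r2 - dot r1 r2 ^+ 2 =
  sin w.1 ^+ 2 * ((b * c) ^+ 2 * sphere 0 w ^+ 2 + (a * c) ^+ 2 * sphere 1 w ^+ 2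
                  + (a * b) ^+ 2 * sphere 2 w ^+ 2).
Proof.
case: w => t p /=.
have -> : derive1 (fun x => ellipsoid_chart a b c (x, p)) t =
    vec3 (a * (cos t * cos p)) (b * (cos t * sin p)) (c * - sin t).
  apply: derive1_vec3.
  - under eq_fun do rewrite [sin _ * _]mulrC.
    rewrite [cos t * _]mulrC.
    exact: (is_derive_mull a (is_derive_mull (cos p) (is_derive_sin t))).
  - under eq_fun do rewrite [sin _ * _]mulrC.
    rewrite [cos t * _]mulrC.
    exact: (is_derive_mull b (is_derive_mull (sin p) (is_derive_sin t))).
have -> : derive1 (fun x => ellipsoid_chart a b c (t, x)) p =
    vec3 (a * (sin t * - sin p)) (b * (sin t * cos p)) 0.
  apply: derive1_vec3.
  - exact: (is_derive_mull a (is_derive_mull (sin t) (is_derive_cos p))).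
  - exact: (is_derive_mull b (is_derive_mull (sin t) (is_derive_sin p))).
  - exact: (is_derive_cst (c * cos t) p 1).
rewrite !dot_vec3 sphere0E sphere1E sphere2E/=.
(* Lagrange's identity; the third coordinate of the cross product is
   [a * b * sin t * cos t * (cos p ^+ 2 + sin p ^+ 2)] *)
transitivity ((b * c * sin t ^+ 2 * cos p) ^+ 2 + (a * c * sin t ^+ 2 * sin p) ^+ 2
  + (a * b * (sin t * cos t) * (cos p ^+ 2 + sin p ^+ 2)) ^+ 2).
  move: (sin t) (cos t) (sin p) (cos p) => *; ring.
by rewrite cos2Dsin2; move: (sin t) (cos t) (sin p) (cos p) => *; ring.
Qed.

(** The area density, relative to the unit sphere, of the ellipsoid of revolution
    with semi-axis [m] along its axis and [M] across; [x] is the square of the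
    coordinate on the axis. *)
Definition axial_density M m (x : R) : R :=
  M * Num.sqrt (m ^+ 2 + (M ^+ 2 - m ^+ 2) * x).

(** In terms of the coordinates on the unit sphere the squared density has the
    squared products of two semi-axes as coefficients; each is at most [M ^+ 4], or
    [M ^+ 2 * m ^+ 2] if the semi-axis [m] is one of its factors. *)
Lemma area_density_le a b c m M n w : 0 < m -> m <= a <= M -> m <= b <= M ->
  m <= c <= M -> m = [:: a; b; c]`_n -> angles w ->
  Num.sqrt (sin w.1 ^+ 2 * ((b * c) ^+ 2 * sphere 0 w ^+ 2
    + (a * c) ^+ 2 * sphere 1 w ^+ 2 + (a * b) ^+ 2 * sphere 2 w ^+ 2)) <=
  sin w.1 * axial_density M m (sphere n w ^+ 2).
Proof.
move=> m0 /andP[ma aM] /andP[mb bM] /andP[mc cM] mE wU.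
have s0 := sin_ge0_angles wU.
have a0 := lt_le_trans m0 ma; have b0 := lt_le_trans m0 mb.
have c0 := lt_le_trans m0 mc; have M0 := lt_le_trans a0 aM.
rewrite sqrtrM ?sqr_ge0// sqrtr_sqr ger0_norm// ler_wpM2l//.
rewrite /axial_density -[X in X * Num.sqrt _](gtr0_norm M0) -sqrtr_sqr -sqrtrM ?sqr_ge0//.
rewrite ler_wsqrtr//.
have sq2 (x y z t : R) : 0 < x -> x <= y -> 0 < z -> z <= t ->
    (x * z) ^+ 2 <= y ^+ 2 * t ^+ 2.
  move=> x0 xy z0 zt; rewrite exprMn ler_pM ?sqr_ge0// lerXn2r// nnegrE ltW//.
    exact: lt_le_trans xy.
  exact: lt_le_trans zt.
have := sphere_sqr w; have := sqr_ge0 (sphere 0 w).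
have := sqr_ge0 (sphere 1 w); have := sqr_ge0 (sphere 2 w).
case: (ord3P n) mE => -> /= -> {s0}; set x := sphere 0 w ^+ 2;
  set y := sphere 1 w ^+ 2; set z := sphere 2 w ^+ 2 => z0 y0 x0 xyz.
- have h1 := sq2 _ _ _ _ b0 bM c0 cM.
  have h2 : (a * c) ^+ 2 <= M ^+ 2 * a ^+ 2 by rewrite mulrC; apply: sq2.
  have h3 : (a * b) ^+ 2 <= M ^+ 2 * a ^+ 2 by rewrite mulrC; apply: sq2.
  have -> : M ^+ 2 * (a ^+ 2 + (M ^+ 2 - a ^+ 2) * x) =
      M ^+ 2 * M ^+ 2 * x + M ^+ 2 * a ^+ 2 * y + M ^+ 2 * a ^+ 2 * z.
    have -> : x = 1 - y - z by rewrite -xyz; ring.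
    by ring.
  by rewrite !lerD// ler_wpM2r.
- have h1 : (b * c) ^+ 2 <= M ^+ 2 * b ^+ 2 by rewrite mulrC; apply: sq2.
  have h2 := sq2 _ _ _ _ a0 aM c0 cM.
  have h3 : (a * b) ^+ 2 <= M ^+ 2 * b ^+ 2 by apply: sq2.
  have -> : M ^+ 2 * (b ^+ 2 + (M ^+ 2 - b ^+ 2) * y) =
      M ^+ 2 * b ^+ 2 * x + M ^+ 2 * M ^+ 2 * y + M ^+ 2 * b ^+ 2 * z.
    have -> : y = 1 - x - z by rewrite -xyz; ring.
    by ring.
  by rewrite !lerD// ler_wpM2r.
- have h1 : (b * c) ^+ 2 <= M ^+ 2 * c ^+ 2 by apply: sq2.
  have h2 : (a * c) ^+ 2 <= M ^+ 2 * c ^+ 2 by apply: sq2.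
  have h3 := sq2 _ _ _ _ a0 aM b0 bM.
  have -> : M ^+ 2 * (c ^+ 2 + (M ^+ 2 - c ^+ 2) * z) =
      M ^+ 2 * c ^+ 2 * x + M ^+ 2 * c ^+ 2 * y + M ^+ 2 * M ^+ 2 * z.
    have -> : z = 1 - x - y by rewrite -xyz; ring.
    by ring.
  by rewrite !lerD// ler_wpM2r.
Qed.

(** Iterating [p |-> p + (r - p ^+ 2) / (2 * M)] from 0 approximates the square root
    of [r := m ^+ 2 + (M ^+ 2 - m ^+ 2) * 'X]: each step multiplies the error by
    [1 - (Num.sqrt r + p) / (2 * M)], which is at most [1 - m / (2 * M)]. *)
Lemma axial_density_uniform_limit M m : 0 < m <= M ->
  uniform_poly_limit (axial_density M m).
Proof.
move=> /andP[m0 mM] e e0; have M0 := lt_le_trans m0 mM.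
pose r : {poly R} := (m ^+ 2)%:P + (M ^+ 2 - m ^+ 2) *: 'X.
pose p k := iter k (fun q => q + (2 * M)^-1 *: (r - q ^+ 2)) 0.
pose q := 1 - m / (2 * M).
have q01 : 0 <= q < 1.
  rewrite /q subr_ge0 ler_pdivrMr ?mulr_gt0// mul1r gtrDl oppr_lt0.
  by rewrite divr_gt0 ?mulr_gt0// andbT; lra.
have pP k x : x \in `[0, 1] ->
    0 <= (p k).[x] /\ 0 <= Num.sqrt r.[x] - (p k).[x] <= M * q ^+ k.
  rewrite in_itv/= => /andP[x0 x1].
  have rE : r.[x] = m ^+ 2 + (M ^+ 2 - m ^+ 2) * x by rewrite !hornerE.
  have mM2 : m ^+ 2 <= M ^+ 2 by rewrite lerXn2r// nnegrE ltW.
  have mr : m ^+ 2 <= r.[x] by rewrite rE lerDl mulr_ge0// subr_ge0.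
  have rM : r.[x] <= M ^+ 2.
    by rewrite rE -lerBrDl -[leRHS]mulr1 ler_wpM2l// subr_ge0.
  have r0 : 0 <= r.[x] by apply: le_trans mr; exact: sqr_ge0.
  have ms : m <= Num.sqrt r.[x] by rewrite -[leLHS]gtr0_norm// -sqrtr_sqr ler_wsqrtr.
  have sM : Num.sqrt r.[x] <= M by rewrite -[leRHS]gtr0_norm// -sqrtr_sqr ler_wsqrtr.
  have s2 := sqr_sqrtr r0; move: ms sM s2; set s := Num.sqrt r.[x] => ms sM s2.
  elim: k => [|k [IH0 /andP[IH1 IH2]]].
    by rewrite /p/= horner0 subr0 expr0 mulr1 lexx sM (le_trans (ltW m0) ms).
  have -> : (p k.+1).[x] = (p k).[x] + (2 * M)^-1 * (s ^+ 2 - (p k).[x] ^+ 2).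
    by rewrite s2 /p/= -/(p k) !hornerE.
  move: IH0 IH1 IH2; set y := (p k).[x] => y0 sy syq.
  have M20 : 0 < 2 * M by rewrite mulr_gt0.
  have sE : s - (y + (2 * M)^-1 * (s ^+ 2 - y ^+ 2)) =
      (s - y) * (1 - (s + y) / (2 * M)) by field; rewrite gt_eqF.
  split; first by rewrite addr_ge0// mulr_ge0 ?invr_ge0 ?(ltW M20)// subr_ge0
    lerXn2r ?nnegrE//; lra.
  rewrite sE; apply/andP; split.
    rewrite mulr_ge0// subr_ge0 ler_pdivrMr// mul1r; lra.
  rewrite exprSr mulrA ler_pM//.
    by rewrite subr_ge0 ler_pdivrMr// mul1r; lra.
  by rewrite /q lerD2l lerN2 ler_wpM2r ?invr_ge0 ?(ltW M20)//; lra.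
have [k qk] : exists k, M * (M * q ^+ k) <= e.
  have /cvgrPdist_le/(_ (e / M ^+ 2)) : q ^+ k @[k --> \oo] --> 0.
    by apply: cvg_expr; rewrite ger0_norm; case/andP: q01.
  rewrite divr_gt0 ?exprn_gt0// => /(_ isT)[k _ /(_ k (leqnn k))].
  rewrite sub0r normrN ger0_norm ?exprn_ge0//; last by case/andP: q01.
  by rewrite ler_pdivlMr ?exprn_gt0// => qk; exists k; rewrite mulrA -expr2 mulrC.
exists (M *: p k) => x x01; have [_ /andP[h1 h2]] := pP k x x01.
rewrite hornerZ /axial_density -mulrBr.
have <- : r.[x] = m ^+ 2 + (M ^+ 2 - m ^+ 2) * x by rewrite !hornerE.
by rewrite ger0_norm ?mulr_ge0 ?(ltW M0)// (le_trans _ qk)// ler_wpM2l// ltW.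
Qed.

End Area.

(** * An upper bound for the area of an ellipsoid *)

Section AreaBound.
Context {R : realType}.
Implicit Types (a b c m M : R).

Local Notation mu := (@lebesgue_measure R).

Lemma axial_density_cos M m t :
  sin t * axial_density M m (cos t ^+ 2) = M * sin t * meridian_speed M m t.
Proof.
rewrite /axial_density /meridian_speed mulrCA -!mulrA; congr (_ * (_ * Num.sqrt _)).
rewrite -[X in X + _]mulr1 -(cos2Dsin2 t); ring.
Qed.

Lemma integral_revolution M m s : 0 <= M -> meridian_arclength M m s ->
  (\int[mu \x mu]_(w in angles)
     (sin w.1 * axial_density M m (sphere 2 w ^+ 2))%:E <=
   (2 * pi * s (pi / 2) ^+ 2)%:E)%E.
Proof.
move=> M0 sP; pose f (t : R) := M * sin t * meridian_speed M m t.
have cf : continuous f by exact: continuous_radius_speed.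
have mf := continuous_measurable_fun cf.
under eq_integral => w _.
  rewrite sphere2E axial_density_cos -[_ * _]mulr1; over.
have pi20 : 0 < 2 * pi :> R by rewrite mulr_gt0// pi_gt0.
rewrite (@integral_rectangle _ f (cst 1))//.
- rewrite (@integral_primitive_increment _ _ _ _ (2 * pi) pi20); last 2 first.
  + exact: cst_continuous.
  + by exists id => [x|]; [exact: is_derive_id|rewrite subr0].
  rewrite muleC [X in (_ <= X)%E]EFinM lee_pmul2l ?lte_fin//.
  rewrite -(@integral_itv_bndoo _ 0 pi (EFin \o f) true false).
    exact: integral_radius_le sP M0.
  by apply/measurable_EFinP; apply: measurable_funS mf.
- move=> t /=; rewrite in_itv/= => /andP[t0 tpi].
  rewrite mulr_ge0 ?meridian_speed_ge0// mulr_ge0// sin_ge0_pi//.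
  by rewrite !ltW.
Qed.

Lemma ellipsoid_area_le a b c m M n s : 0 < m -> m <= a <= M -> m <= b <= M ->
  m <= c <= M -> m = [:: a; b; c]`_(n : 'I_3) -> meridian_arclength M m s ->
  (ellipsoid_area a b c <= (2 * pi * s (pi / 2) ^+ 2)%:E)%E.
Proof.
move=> m0 maM mbM mcM mE sP.
have mM : 0 < m <= M by rewrite m0; case/andP: maM; exact: le_trans.
have M0 : 0 <= M by case/andP: mM => ? ?; lra.
have md : measurable_fun setT (axial_density M m).
  apply: continuous_measurable_fun => x; apply: cvgM; first exact: cvg_cst.
  apply: (@continuous_comp _ _ _ (fun x => m ^+ 2 + (M ^+ 2 - m ^+ 2) * x) Num.sqrt);
    last exact: sqrt_continuous.
  apply: cvgD; first exact: cvg_cst.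
  by apply: cvgM; [exact: cvg_cst|exact: cvg_id].
have d0 x : 0 <= axial_density M m x by rewrite mulr_ge0// sqrtr_ge0.
apply: (@le_trans _ _ (\int[mu \x mu]_(w in angles)
     (sin w.1 * axial_density M m (sphere n w ^+ 2))%:E)%E).
  rewrite /ellipsoid_area /parametrized_area.
  under eq_integral => w _ do rewrite area_densityE.
  apply: ge0_le_integral.
  - exact: measurable_angles.
  - by move=> w _; rewrite lee_fin sqrtr_ge0.
  - have mX (h : R * R -> R) : measurable_fun setT h ->
        measurable_fun setT (fun w => h w ^+ 2).
      move=> mh; have := measurable_funM mh mh.
      by congr measurable_fun; apply/funext => w; rewrite /= expr2.
    have mZ (k : R) (j : 'I_3) :
        measurable_fun setT (fun w : R * R => k * sphere j w ^+ 2).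
      apply: measurable_funM; first exact: measurable_cst.
      exact: mX (measurable_fun_sphere j).
    apply/measurable_EFinP.
    apply: measurable_funS (measurableT) (@subsetT _ _) _.
    have mS : measurable_fun setT (@Num.sqrt R).
      exact: continuous_measurable_fun (@sqrt_continuous R).
    apply: (measurableT_comp mS).
    apply: measurable_funM; first exact: mX measurable_fun_sin1.
    by apply: measurable_funD; [apply: measurable_funD|]; exact: mZ.
  - apply/measurable_EFinP; apply: measurable_funS (measurableT) (@subsetT _ _) _.
    exact: measurable_fun_axial.
  - by move=> w wU; rewrite lee_fin; exact: area_density_le wU.
apply: le_trans (integral_revolution M0 sP).
by apply: integral_sphere_le => //; exact: axial_density_uniform_limit.
Qed.

Lemma ex_max3 a b c :
  exists M, [/\ [\/ M = a, M = b | M = c], a <= M, b <= M & c <= M].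
Proof.
have [ab|/ltW ba] := leP a b; have [ac|/ltW ca] := leP a c;
  have [bc|/ltW cb] := leP b c;
  try (by exists c; split => //; constructor 3);
  try (by exists b; split => //; constructor 2);
  by exists a; split; [constructor 1|lra|lra|lra].
Qed.

Lemma ex_min3 a b c : exists m, exists n : 'I_3,
  [/\ m = [:: a; b; c]`_n, m <= a, m <= b & m <= c].
Proof.
have [ab|/ltW ba] := leP a b; have [ac|/ltW ca] := leP a c;
  have [bc|/ltW cb] := leP b c; try (by exists a, 0); try (by exists b, 1);
  by exists c, 2; split; [|lra|lra|lra].
Qed.

End AreaBound.

Theorem corollary2 (R : realType) (a b c : R)
    (ha : 0 < a) (hb : 0 < b) (hc : 0 < c) :
  (ellipsoid_area a b c / intrinsic_diameter (ellipsoid a b c) ^+ 2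
     <= (pi / 2)%:E)%E.
Proof.
have [M [Mabc aM bM cM]] := ex_max3 a b c.
have [m [n [mE ma mb mc]]] := ex_min3 a b c.
have m0 : 0 < m by rewrite mE; case: (ord3P n) => ->.
have [s sP] := ex_meridian_arclength M m.
have D_ge := le_ellipsoid_diameter m0 ma mb mc Mabc sP.
have A_le := @ellipsoid_area_le R a b c m M n s m0.
rewrite ma mb mc aM bM cM in A_le; have {}A_le := A_le isT isT isT mE sP.
have M0 : 0 < M := lt_le_trans ha aM.
(* This excludes the value [+oo] of a quotient by 0. *)
have K0 : 0 < s (pi / 2).
  apply: lt_le_trans (radius_le_arclength sP (ltW M0) _).
    by rewrite sin_pihalf mulr1.
  by rewrite in_itv/=; have := @pi_gt0 R => ?; apply/andP; split; lra.
have pi2 : 0 <= pi / 2 :> R by rewrite divr_ge0// pi_ge0.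
move: D_ge; case: (intrinsic_diameter _) => [d| |] D_ge.
- have d0 : 0 < d by move: D_ge; rewrite lee_fin; apply: lt_le_trans; rewrite mulrn_wgt0.
  rewrite -EFin_expe inver gt_eqF ?exprn_gt0// lee_pdivrMr ?exprn_gt0//.
  apply: (le_trans A_le).
  rewrite -EFinM lee_fin; rewrite lee_fin in D_ge.
  have -> : 2 * pi * s (pi / 2) ^+ 2 = pi / 2 * (s (pi / 2) *+ 2) ^+ 2 by field.
  by rewrite ler_wpM2l// lerXn2r// nnegrE ltW// mulrn_wgt0.
(* A quotient by [+oo] is 0. *)
- by rewrite expe2 mulyy invey mule0 lee_fin.
- by move: D_ge; rewrite leNgt ltNyr.
Qed.
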